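(* Let $B$ be the $\mathbb N$-infinite Pascal-Bratteli diagram. (1) Let $\overline d=\langle d_i:i\in\mathbb N\rangle$ be a probability vector and for $n\in\mathbb N$ define $\overline p^{(n)}=\langle p^{(n)}_{\overline s}:\overline s\in V_n\rangle$ by $p^{(n)}_{\overline s}=\prod_i d_i^{s_i}$ for $\overline s=(s_1,s_2,\ldots)\in V_n$. Then $\overline d$ determines uniquely a probability tail invariant measure $\mu_{\overline d}$ on the path space $X_B$, namely the one with $\mu_{\overline d}([\overline e])=p^{(n)}_{\overline s}$ for every finite path $\overline e$ from $V_1$ to $\overline s\in V_n$, $n\in\mathbb N$. (2) Suppose that for every $n\in\mathbb N$, $\overline d^{(n)}=\langle d_{n,i}:i=1,2,\ldots\rangle$ is a probability vector and $\overline q^{(n)}(\overline d^{(n)})=\langle q^{(n)}_{\overline s}(\overline d^{(n)}):\overline s\in V_n\rangle$ is the vector from $L^{(n)}$ given by $$q^{(n)}_{\overline s}(\overline d^{(n)})=\frac{n!}{\prod_i s_i!}\prod_i d_{n,i}^{s_i},\qquad \overline s=(s_1,s_2,\ldots)\in V_n.$$ Then the sequence of vectors $\overline q^{(n)}(\overline d^{(n)})$, $n\in\mathbb N$, determines a tail invariant probability measure on $X_B$ (i.e. there is a tail invariant probability measure $\mu$ with $\mu(X^{(n)}_{\overline s})=q^{(n)}_{\overline s}(\overline d^{(n)})$ for all $n\in\mathbb N$, $\overline s\in V_n$) if and only if there is a vector $\overline d$ with $\overline d^{(n)}=\overline d$ for every $n\in\mathbb N$.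
   Context: The $\mathbb N$-infinite Pascal-Bratteli diagram has levels $V_n=\{\overline s=(s_1,s_2,\ldots): s_i\in\mathbb Z_{\ge0},\ \sum_{i\ge1}s_i=n\}$, $n\in\mathbb N=\{1,2,\ldots\}$, with exactly one edge from $\overline s\in V_n$ to $\overline t\in V_{n+1}$ if $\overline t=\overline s+\overline e^{(i)}$ for some $i\in\mathbb N$ ($\overline e^{(i)}$ the $i$-th standard basis vector), and no edge otherwise. The path space $X_B$ is the set of infinite paths starting at $V_1$, with topology generated by cylinder sets $[\overline e]$ (infinite paths with prescribed finite initial path $\overline e$; a path of length $0$ is a vertex of $V_1$). $X^{(n)}_{\overline s}$ is the set of infinite paths whose level-$n$ vertex is $\overline s$. A Borel measure on $X_B$ is tail invariant if it takes equal values on cylinder sets of finite paths (starting in $V_1$) with the same terminal vertex. A probability vector has nonnegative entries with sum $1$; $0^0=1$. $L^{(n)}$: for $\overline t\in V_{n+m}$, $\overline s\in V_n$ let $g^{(n,m)}_{\overline t\,\overline s}=N(\overline s,\overline t)H^{(n)}_{\overline s}/H^{(n+m)}_{\overline t}$, where $N(\overline s,\overline t)$ is the number of finite paths from $\overline s$ to $\overline t$ and $H^{(n)}_{\overline s}$ the number of finite paths from $V_1$ to $\overline s$, and $\overline g^{(n,m)}_{\overline t}=\langle g^{(n,m)}_{\overline t\,\overline s}:\overline s\in V_n\rangle$. $L^{(n)}$ is the set of all coordinatewise limits of convergent sequences $\overline g^{(n,m)}_{\overline t^{(m)}}$, $m\to\infty$, with $\overline t^{(m)}\in V_{n+m}$.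 *)

(* Defs.v *)
From HB Require Import structures.
From mathcomp Require Import all_boot all_order all_algebra finmap.
From mathcomp Require Import all_classical all_reals all_analysis.

Set Implicit Arguments.
Unset Strict Implicit.
Unset Printing Implicit Defensive.

Import Order.TTheory GRing.Theory Num.Theory.
Import numFieldNormedType.Exports.
Local Open Scope classical_set_scope.
Local Open Scope ring_scope.

(* The coordinates s_1, s_2, ... are indexed from 0. *)
Notation vertex := {fsfun nat -> nat with 0%N}.

Definition degree (s : vertex) : nat := (\sum_(i <- finsupp s) s i)%N.

(* [level n] is V_n for n >= 1; the diagram has no level 0, hence the
   hypotheses [0 < n] throughout. *)
Definition level (n : nat) : Type := {s : vertex | degree s == n}.

Definition edge : rel vertex :=
  fun s t => `[< exists i : nat, forall j, t j = (s j + (j == i))%N >].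

(* There is at most one edge between two vertices, so a path is determined by
   the sequence of its vertices.  [paths s t] is the set of finite paths from s
   to t, the starting vertex s being left out of the sequence. *)
Definition paths (s t : vertex) : set (seq vertex) :=
  [set p | path edge s p /\ last s p = t].

(* [paths_from_V1 t]: finite paths from V_1 to t, as pairs made of the starting
   vertex and the subsequent vertices (no subsequent vertex for length 0). *)
Definition paths_from_V1 (t : vertex) : set (vertex * seq vertex) :=
  [set e | degree e.1 = 1%N /\ paths e.1 t e.2].

Definition num_paths (s t : vertex) : nat := #|` fset_set (paths s t)|%fset.

Definition height (t : vertex) : nat := #|` fset_set (paths_from_V1 t)|%fset.

(* The vertex of level n of an infinite path w is [w n.-1]. *)
Record path_space : Type := PathSpace {
  path_vertex :> nat -> vertex;
  path_start : degree (path_vertex 0%N) = 1%N;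
  path_step : forall k, edge (path_vertex k) (path_vertex k.+1)
}.

Definition cylinder (e : vertex * seq vertex) : set path_space :=
  [set w | forall k, (k <= size e.2)%N -> w k = nth e.1 (e.1 :: e.2) k].

Definition cylinders : set (set path_space) :=
  [set cylinder e | e in \bigcup_t paths_from_V1 t].

(* The straight path k |-> (k+1) e^(1), only used as the distinguished point
   that measurable types carry. *)
Definition straight_vertex (k : nat) : vertex :=
  [fsfun i in [fset 0%N]%fset => k.+1 | 0%N].

Lemma straight_vertexE k j :
  straight_vertex k j = if j == 0%N then k.+1 else 0%N.
Proof. by rewrite fsfunE inE. Qed.

Lemma straight_start : degree (straight_vertex 0) = 1%N.
Proof.
rewrite /degree; have -> : finsupp (straight_vertex 0) = [fset 0%N]%fset.
  by apply/fsetP => j; rewrite mem_finsupp straight_vertexE inE; case: (j == _).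
by rewrite big_seq_fset1 straight_vertexE.
Qed.

Lemma straight_step k : edge (straight_vertex k) (straight_vertex k.+1).
Proof.
apply/asboolP; exists 0%N => j; rewrite !straight_vertexE.
by case: (j == _); rewrite ?addn1.
Qed.

HB.instance Definition _ := gen_eqMixin path_space.
HB.instance Definition _ := gen_choiceMixin path_space.
HB.instance Definition _ :=
  isPointed.Build path_space (PathSpace straight_start straight_step).
HB.instance Definition _ :=
  @isSubBaseTopological.Build path_space (set path_space) cylinders id.

Notation borel_path_space := (g_sigma_algebraType (@open path_space)).

(* X^{(n)}_s *)
Definition through (n : nat) (s : level n) : set path_space :=
  [set w | w n.-1 = val s].

Section Definitions.
Variable R : realType.

Definition tail_invariant (mu : {measure set borel_path_space -> \bar R}) :
    Prop :=
  forall (t : vertex) (e e' : vertex * seq vertex),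
    paths_from_V1 t e -> paths_from_V1 t e' ->
    mu (cylinder e) = mu (cylinder e').

Definition probability_vector (d : nat -> R) : Prop :=
  (forall i, 0 <= d i) /\ (\sum_(0 <= i <oo) (d i)%:E = 1)%E.

Definition p_vec (n : nat) (d : nat -> R) (s : level n) : R :=
  \prod_(i <- finsupp (val s)) d i ^+ (val s i).

Definition q_vec (n : nat) (d : nat -> R) (s : level n) : R :=
  n`!%:R / (\prod_(i <- finsupp (val s)) (val s i)`!)%N%:R *
  \prod_(i <- finsupp (val s)) d i ^+ (val s i).

Definition g_vec (n m : nat) (t : level (n + m)) (s : level n) : R :=
  (num_paths (val s) (val t))%:R * (height (val s))%:R / (height (val t))%:R.

(* L^{(n)} *)
Definition limit_vectors (n : nat) : set (level n -> R) :=
  [set l : level n -> R | exists t : forall m, level (n + m),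
    forall s, (fun m => g_vec (t m) s) @ \oo --> l s].

End Definitions.

Arguments p_vec {R} n d s.
Arguments q_vec {R} n d s.
Arguments limit_vectors {R} n _.

(* Main.v *)
Require Import Defs.
From HB Require Import structures.
From mathcomp Require Import all_boot all_order all_algebra finmap.
From mathcomp Require Import all_classical all_reals all_analysis.
From mathcomp Require Import zify ring lra.

Import Order.TTheory GRing.Theory Num.Theory.
Import numFieldNormedType.Exports.
Local Open Scope classical_set_scope.
Local Open Scope ring_scope.

(** Paths of the diagram are words: a path that starts in V_1 is determined by
    the sequence of coordinates that its successive edges increment, the first
    of them telling the starting vertex, and its vertex at level n records how
    often each letter occurs among the first n letters of the word. Everything
    below is read through this dictionary.

    Counting. The paths from s to t are the rearrangements of a word with
    t_i - s_i letters i, so their number is a multinomial coefficient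
    ([num_paths_fact]), and so is the height of a vertex ([height_fact]). Hence
    g_{t s} equals n!/prod s_i! times prod t_i(t_i-1)...(t_i-s_i+1), divided by
    N(N-1)...(N-n+1) where N = n + m ([g_vec_ffact]). If t_i/N tends to d_i for
    every i, this tends to q_s(d); such vertices t exist, by rounding the
    numbers N d_i to integers whose sum is N ([exists_rounding]). This gives
    [q_vec_limit].

    Existence and uniqueness. The required measure makes the letters
    independent with common distribution d. It is the image of the uniform
    measure on [0, 1[ under the map that sends u to its sequence of digits,
    where [0, 1[ is cut into intervals of lengths d_0, d_1, ..., each of them is
    cut in the same proportions, and so on: the numbers u whose digits begin
    with a word v form an interval whose length is the product of the d_i over
    the letters i of v ([digits_cell]). Uniqueness holds because cylinders,
    together with the empty set, are stable under intersection and generate the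
    Borel sets ([measure_cylinders_unique]).

    The equivalence. For a tail invariant mu, all cylinders of paths ending at s
    have the same measure, and there are H_s of them, so that
    mu(X_s) = H_s mu([e]); with the value q_s(d^(n)) = H_s p_s(d^(n)) this gives
    mu([e]) = p_s(d^(n)) ([measure_word]). Apply it to the path spelled by n
    copies of i and to its one-letter extensions: by additivity,
    (d_{n,i})^n = sum_j (d_{n+1,i})^n d_{n+1,j} = (d_{n+1,i})^n, whence
    d_{n,i} = d_{n+1,i}. Conversely, when all d^(n) equal d, the measure of the
    first part has the prescribed values. *)

(** * Multinomial coefficients *)

Lemma sum_count_mem (T : eqType) (U w : seq T) :
  uniq U -> {subset w <= U} -> (\sum_(x <- U) count_mem x w = size w)%N.
Proof.
move=> uU; elim: w => [|y w IH] sub /=.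
  by apply: big1_seq.
rewrite big_split /= IH; last by move=> z zw; apply: sub; rewrite inE zw orbT.
rewrite (bigD1_seq y) //=; last by apply: sub; rewrite inE eqxx.
rewrite eqxx big1 ?addn0 // => z; by rewrite eq_sym => /negbTE ->.
Qed.

(** Classify the rearrangements of w by their first letter x. Removing one x
    lowers its multiplicity by one, so, once multiplied by the product of the
    factorials, the class of x counts for its multiplicity times (n-1)!, where n
    is the size of w; and the multiplicities add up to n. *)
Lemma size_permutations_multiset (T : eqType) (U w : seq T) :
  uniq U -> {subset w <= U} ->
  (size (permutations w) * \prod_(x <- U) (count_mem x w)`! = (size w)`!)%N.
Proof.
move=> uU; move sw: (size w) => n; elim: n w sw => [|n IH] w sw sub.
  by move/size0nil: sw => ->; rewrite big1.
rewrite (perm_size (permutationsE _)) ?sw// size_allpairs_dep sumnE big_map.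
rewrite big_distrl /=.
transitivity (\sum_(x <- undup w) count_mem x w * n`!)%N; last first.
  rewrite -big_distrl /= sum_count_mem ?undup_uniq //.
    by rewrite sw factS.
  by move=> x; rewrite mem_undup.
apply: eq_big_seq => x; rewrite mem_undup => xw.
have xU := sub x xw.
rewrite -(IH (rem x w)); [|by rewrite size_rem ?sw|by move=> z /mem_rem/sub].
rewrite mulnCA; congr (_ * _)%N.
rewrite [in LHS](bigD1_seq x) //= [in RHS](bigD1_seq x) //= mulnA.
congr (_ * _)%N.
  have : (0 < count_mem x w)%N by rewrite -has_count has_pred1.
  rewrite (permP (perm_to_rem xw) (pred1 x)) /= eqxx.
  by rewrite add1n factS.
apply: eq_bigr => z; rewrite eq_sym => /negbTE zx.
by rewrite (permP (perm_to_rem xw) (pred1 z)) /= zx.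
Qed.

(** * Paths as words *)

Definition vstep (s : vertex) (i : nat) : vertex :=
  [fsfun j in (i |` finsupp s)%fset => (s j + (j == i))%N | 0%N].

Lemma vstepE s i j : vstep s i j = (s j + (j == i))%N.
Proof.
rewrite fsfunE; case: ifPn => //; rewrite !inE negb_or => /andP[/negbTE -> js].
by rewrite addn0 (fsfun_dflt js).
Qed.

Lemma edgeP (s t : vertex) : reflect (exists i, t = vstep s i) (edge s t).
Proof.
apply: (iffP (asboolP _)) => -[i] H; exists i; last first.
  by move=> j; rewrite H vstepE.
by apply/fsfunP => j; rewrite vstepE.
Qed.

Lemma vstep_inj s : injective (vstep s).
Proof.
move=> i j /(congr1 (fun t : vertex => t j)); rewrite !vstepE eqxx => /addnI.
by case: eqP.
Qed.

Definition vertex0 : vertex := [fsfun].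

Lemma vertex0E j : vertex0 j = 0%N.
Proof. by rewrite fsfunE. Qed.

(** Degrees of different vertices are compared by summing over a common set of
    coordinates. *)
Lemma degree_sub (A : {fset nat}) (s : vertex) :
  (finsupp s `<=` A)%fset -> degree s = (\sum_(i <- A) s i)%N.
Proof.
move=> sub; rewrite /degree; apply: big_fset_incl => // i _.
exact: fsfun_dflt.
Qed.

Lemma foldl_vstepE s w j : foldl vstep s w j = (s j + count_mem j w)%N.
Proof.
elim: w s => [|i w IH] s /=; first by rewrite addn0.
by rewrite IH vstepE -addnA eq_sym.
Qed.

(** One word with prescribed letter counts; the others are its
    rearrangements. *)
Definition spell (s : vertex) : seq nat :=
  flatten [seq nseq (s i) i | i <- finsupp s].

Lemma count_spell s i : count_mem i (spell s) = s i.
Proof.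
rewrite /spell count_flatten -map_comp sumnE big_map.
transitivity (\sum_(j <- finsupp s) (j == i) * s j)%N.
  by apply: eq_bigr => j _; rewrite /= count_nseq.
have [si|si] := boolP (i \in finsupp s).
  rewrite (bigD1_seq i) ?fset_uniq //= eqxx mul1n big1 ?addn0 // => j ji.
  by rewrite (negbTE ji).
rewrite (fsfun_dflt si) big1_seq // => j /= js.
by have [ji|//] := eqVneq j i; rewrite -ji js in si.
Qed.

Lemma mem_spell s i : i \in spell s = (i \in finsupp s).
Proof. by rewrite -has_pred1 has_count count_spell mem_finsupp lt0n. Qed.

Lemma foldl_spell s : foldl vstep vertex0 (spell s) = s.
Proof. by apply/fsfunP => j; rewrite foldl_vstepE vertex0E count_spell. Qed.

Lemma size_spell s : size (spell s) = degree s.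
Proof.
rewrite -(@sum_count_mem _ (finsupp s)) ?fset_uniq //.
  by apply: eq_bigr => i _; rewrite count_spell.
by move=> i; rewrite mem_spell.
Qed.

Lemma degree_foldl s w : degree (foldl vstep s w) = (degree s + size w)%N.
Proof.
pose A := (finsupp (foldl vstep s w) `|` finsupp s `|` [fset i in w])%fset.
rewrite (@degree_sub A) ?(@degree_sub A s) /A.
- under eq_bigr do rewrite foldl_vstepE.
  rewrite big_split /= sum_count_mem ?fset_uniq // => i iw.
  by rewrite !inE iw orbT.
- by apply/fsubsetP => i; rewrite !inE => ->; rewrite orbT.
- by apply/fsubsetP => i; rewrite !inE => ->.
Qed.

Lemma degree0 : degree vertex0 = 0%N.
Proof. by rewrite /degree big1 // => i _; rewrite vertex0E. Qed.

(** The dictionary between paths and words: the edge added at each step names a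
    letter, and the vertices of the path are the partial sums. *)
Lemma paths_scanl s t p : paths s t p <->
  exists2 w, p = scanl vstep s w & t = foldl vstep s w.
Proof.
split=> [[ps <-]|[w -> ->]].
  elim: p s ps => [|u p IH] s /=; first by exists [::].
  case/andP => /edgeP[i ->] /IH[w pE lE].
  by exists (i :: w); rewrite /= ?lE -?pE.
split; last by elim: w s => //= i w IH s.
by elim: w s => //= i w IH s; rewrite IH andbT; apply/edgeP; exists i.
Qed.

Lemma scanl_vstep_inj s : injective (scanl vstep s).
Proof.
move=> w w'; elim: w w' s => [|i w IH] [|j w'] s //= [/vstep_inj <-].
by move=> /IH ->.
Qed.

(** The end of a path remembers the letter counts of its word and nothing
    else. *)
Lemma foldl_vstep_perm s w0 w :
  foldl vstep s w = foldl vstep s w0 <-> perm_eq w w0.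
Proof.
split=> [H|/permP H].
  apply/allP => i _; apply/eqP.
  have := congr1 (fun t : vertex => t i) H.
  by rewrite !foldl_vstepE => /addnI.
by apply/fsfunP => j; rewrite !foldl_vstepE H.
Qed.

Lemma pathsE s w0 : paths s (foldl vstep s w0) =
  [set` [fset p in map (scanl vstep s) (permutations w0)]%fset].
Proof.
apply/seteqP; split => p /=.
  rewrite !inE => /paths_scanl[w -> /esym/foldl_vstep_perm H].
  by apply: map_f; rewrite mem_permutations.
rewrite !inE => /mapP[w]; rewrite mem_permutations => H ->.
by apply/paths_scanl; exists w => //; apply/esym/foldl_vstep_perm.
Qed.

Lemma num_paths_foldl s w0 :
  num_paths s (foldl vstep s w0) = size (permutations w0).
Proof.
rewrite /num_paths pathsE set_fsetK card_fseq undup_id ?size_map //.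
by rewrite map_inj_uniq ?permutations_uniq //; apply: scanl_vstep_inj.
Qed.

Lemma vertex_diff (s t : vertex) : (forall i, s i <= t i)%N ->
  exists w, t = foldl vstep s w.
Proof.
move=> st.
pose u : vertex := [fsfun i in finsupp t => (t i - s i)%N | 0%N].
exists (spell u); apply/fsfunP => i; rewrite foldl_vstepE count_spell fsfunE.
case: ifPn => [_|it]; first by rewrite subnKC.
by have := st i; rewrite (fsfun_dflt it) leqn0 => /eqP ->.
Qed.

Lemma num_paths_fact (s t : vertex) (U : {fset nat}) :
  (finsupp t `<=` U)%fset ->
  (forall i, s i <= t i)%N ->
  (num_paths s t * \prod_(i <- U) (t i - s i)`! = (degree t - degree s)`!)%N.
Proof.
move=> tU /[dup] st /vertex_diff[w tE].
have E i : (t i - s i = count_mem i w)%N by rewrite tE foldl_vstepE addKn.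
under eq_bigr do rewrite E.
rewrite tE num_paths_foldl size_permutations_multiset ?fset_uniq //; last first.
  move=> i iw; apply: (fsubsetP tU); rewrite mem_finsupp tE foldl_vstepE.
  by rewrite -lt0n addn_gt0 -has_count has_pred1 iw orbT.
by rewrite degree_foldl addKn.
Qed.

Lemma num_paths_eq0 (s t : vertex) i : (t i < s i)%N -> num_paths s t = 0%N.
Proof.
move=> ts; rewrite /num_paths; suff -> : paths s t = set0.
  by rewrite fset_set0 cardfs0.
apply/seteqP; split => // p /paths_scanl[w _ tE].
by move: ts; rewrite tE foldl_vstepE ltnNge leq_addr.
Qed.

(** Prepending the zero vertex, from which there is an edge to every vertex of
    V_1, turns a path from V_1 into the path of a nonempty word from zero. *)
Lemma paths_from_V1P t e : paths_from_V1 t e <->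
  exists2 w, (0 < size w)%N & e.1 :: e.2 = scanl vstep vertex0 w /\
    t = foldl vstep vertex0 w.
Proof.
case: e => v p; rewrite /paths_from_V1 /=; split.
  case=> dv /paths_scanl[w -> ->].
  have := size_spell v; have := foldl_spell v; rewrite dv.
  case: (spell v) => [//|i [|//]] /= <- _.
  by exists (i :: w).
case=> -[//|i w] _ /= [[-> ->] ->]; split.
  by have := degree_foldl vertex0 [:: i]; rewrite degree0.
by apply/paths_scanl; exists w.
Qed.

Lemma paths_from_V1E t : (0 < degree t)%N ->
  paths_from_V1 t = (fun e => e.1 :: e.2) @^-1` paths vertex0 t.
Proof.
move=> dt; apply/seteqP; split => e.
  by move=> /paths_from_V1P[w _ [E F]] /=; apply/paths_scanl; exists w.
move=> /= /paths_scanl[w E F]; apply/paths_from_V1P; exists w => //.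
by move: E; case: w {F}.
Qed.

Lemma height_num_paths t : (0 < degree t)%N -> height t = num_paths vertex0 t.
Proof.
move=> dt; rewrite /height /num_paths.
pose f (e : vertex * seq vertex) := e.1 :: e.2.
have fin0 : finite_set (paths vertex0 t).
  by rewrite -(foldl_spell t) pathsE; exact: finite_fset.
have E : paths vertex0 t = f @` paths_from_V1 t.
  rewrite paths_from_V1E //; apply/seteqP; split => [p|_ [e He <-] //].
  case: p => [|v p] H; last by exists (v, p).
  case: H => _ /= H; move: dt; rewrite -H degree0 //.
have finj : {in paths_from_V1 t &, injective f}.
  by move=> [a b] [c d] _ _ [-> ->].
apply/esym/fcard_eq => //; last by rewrite E; exact: inj_card_eq.
rewrite paths_from_V1E //; apply: finite_preimage => // [[a b] [c d]] _ _.
by move=> [-> ->].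
Qed.

Lemma height_fact (t : vertex) (U : {fset nat}) :
  (finsupp t `<=` U)%fset -> (0 < degree t)%N ->
  (height t * \prod_(i <- U) (t i)`! = (degree t)`!)%N.
Proof.
move=> tU dt; rewrite height_num_paths //.
have := @num_paths_fact vertex0 t U tU; rewrite degree0 subn0.
under eq_bigr do rewrite vertex0E subn0.
by apply=> i; rewrite vertex0E.
Qed.

(** * The vectors q^(n)(d) belong to L^(n) *)

(** A form of the path counts without divisions. It also covers the case where
    s is not below t: there is no path, and a falling factorial on the right
    vanishes. *)
Lemma num_paths_ffact (s t : vertex) :
  (0 < degree s)%N -> (degree s <= degree t)%N ->
  (num_paths s t * height s * degree t ^_ degree s *
    \prod_(i <- finsupp s) (s i)`! =
   height t * (degree s)`! * \prod_(i <- finsupp s) t i ^_ s i)%N.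
Proof.
move=> s0 st; have t0 := leq_trans s0 st.
have [/existsNP[i /negP]|/contrapT le_st] :=
  pselect (~ forall i, (s i <= t i)%N).
  rewrite -ltnNge => ti; rewrite (num_paths_eq0 _ _ _ ti) !mul0n.
  rewrite (bigD1_seq i) ?fset_uniq //=; last first.
    by rewrite mem_finsupp -lt0n (leq_trans _ ti).
  by rewrite ffact_small // mul0n muln0.
have sub : (finsupp s `<=` finsupp t)%fset.
  apply/fsubsetP => i; rewrite !mem_finsupp -!lt0n => /leq_trans; exact.
have Hs := height_fact _ _ (fsubset_refl _) s0.
have Ht := height_fact _ _ (fsubset_refl _) t0.
have Hst := num_paths_fact _ _ _ (fsubset_refl _) le_st.
have Hf := ffact_fact st.
have E : (\prod_(i <- finsupp t) (t i)`! = \prod_(i <- finsupp s) t i ^_ s i *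
    \prod_(i <- finsupp t) (t i - s i)`!)%N.
  have -> : (\prod_(i <- finsupp s) t i ^_ s i =
             \prod_(i <- finsupp t) t i ^_ s i)%N.
    by apply: big_fset_incl => // i _ /fsfun_dflt ->.
  by rewrite -big_split; apply: eq_bigr => i _ /=; rewrite ffact_fact.
have P0 : (0 < \prod_(i <- finsupp t) (t i - s i)`!)%N.
  by apply: prodn_gt0 => i; rewrite fact_gt0.
move: E Hs Ht Hst Hf P0.
set A := (\prod_(i <- finsupp t) (t i - s i)`!)%N.
set B := (\prod_(i <- finsupp s) (s i)`!)%N.
set C := (\prod_(i <- finsupp s) t i ^_ s i)%N.
move=> -> Hs Ht Hst Hf A0.
apply/eqP; rewrite -(eqn_pmul2r A0); apply/eqP.
transitivity ((degree s)`! * (degree t)`!)%N.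
  by rewrite -Hs -Hf -Hst; lia.
by rewrite -Ht; lia.
Qed.

Section Limits.
Variable R : realType.
Implicit Types (d : nat -> R).

Lemma g_vec_ffact (n m : nat) (t : level (n + m)) (s : level n) : (0 < n)%N ->
  g_vec R t s = n`!%:R / (\prod_(i <- finsupp (val s)) (val s i)`!)%N%:R *
    ((\prod_(i <- finsupp (val s)) val t i ^_ val s i)%N%:R /
     ((n + m) ^_ n)%N%:R).
Proof.
move=> n0; have ds : degree (val s) = n by apply/eqP/(valP s).
have dt : degree (val t) = (n + m)%N by apply/eqP/(valP t).
have := @num_paths_ffact (val s) (val t).
rewrite ds dt n0 leq_addr => /(_ isT isT).
have := @height_fact (val t) _ (fsubset_refl _).
rewrite dt addn_gt0 n0 => /(_ isT).
rewrite /g_vec.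
set A := (\prod_(i <- finsupp (val t)) _)%N.
set B := (\prod_(i <- finsupp (val s)) (val s i)`!)%N.
set C := (\prod_(i <- finsupp (val s)) val t i ^_ val s i)%N.
move=> H /(congr1 (fun k => k%:R : R)); rewrite !natrM => E.
have B0 : (B%:R : R) != 0.
  by rewrite pnatr_eq0 -lt0n; apply: prodn_gt0 => i; rewrite fact_gt0.
have H0 : ((height (val t))%:R : R) != 0.
  rewrite pnatr_eq0; apply/eqP => h0; move: H; rewrite h0 mul0n => /esym/eqP.
  by rewrite -[_ == _]negbK -lt0n fact_gt0.
have F0 : (((n + m) ^_ n)%N%:R : R) != 0.
  by rewrite pnatr_eq0 -lt0n ffact_gt0 leq_addr.
apply: (mulIf (mulf_neq0 (mulf_neq0 B0 H0) F0)).
transitivity ((num_paths (val s) (val t))%:R * (height (val s))%:R *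
    ((n + m) ^_ n)%:R * B%:R : R).
  by field.
by rewrite E; field; rewrite F0 B0.
Qed.

Lemma cvg_invn (n : nat) : (0 < n)%N ->
  (fun m => (n + m)%:R^-1 : R) @ \oo --> (0 : R).
Proof.
case: n => // n _; have := @cvg_harmonic R; rewrite -(cvg_shiftn n).
apply: cvg_trans; apply: near_eq_cvg.
by apply: nearW => m /=; rewrite addSn addnC.
Qed.

Lemma cvg_prod_seq (I : Type) (r : seq I) (f : I -> nat -> R) (l : I -> R) :
  (forall i, f i @ \oo --> l i) ->
  (fun m => \prod_(i <- r) f i m) @ \oo --> \prod_(i <- r) l i.
Proof.
move=> fl; elim: r => [|i r IH].
  by under eq_fun do rewrite big_nil; rewrite big_nil; exact: cvg_cst.
by under eq_fun do rewrite big_cons; rewrite big_cons; exact: cvgM.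
Qed.

(** Replacing a^k by the falling factorial changes each factor by at most k,
    which is negligible after division by n + m. *)
Lemma cvg_ffact (n : nat) (a : nat -> nat) (x : R) k :
  (0 < n)%N -> (fun m => (a m)%:R / (n + m)%:R : R) @ \oo --> x ->
  (fun m => (a m ^_ k)%:R / (n + m)%:R ^+ k : R) @ \oo --> x ^+ k.
Proof.
move=> n0 ax; elim: k => [|k IH].
  by under eq_fun do rewrite ffactn0 expr0 divr1; exact: cvg_cst.
have -> : (fun m => (a m ^_ k.+1)%:R / (n + m)%:R ^+ k.+1 : R) =
  (fun m => (a m ^_ k)%:R / (n + m)%:R ^+ k) \*
  (fun m => (a m - k)%:R / (n + m)%:R).
  by apply/funext => m /=; rewrite ffactnSr natrM exprSr invfM mulrACA.
rewrite exprSr; apply: cvgM => //.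
have inv0 : (fun m => k%:R / (n + m)%:R : R) @ \oo --> (0 : R).
  by rewrite -(mulr0 k%:R); apply: cvgMr; exact: cvg_invn.
have ax' : (fun m => (a m)%:R / (n + m)%:R - k%:R / (n + m)%:R : R) @ \oo --> x.
  by rewrite -(subr0 x); apply: cvgB.
apply: squeeze_cvgr ax' ax; apply: nearW => m.
have p0 : 0 < (n + m)%:R^-1 :> R by rewrite invr_gt0 ltr0n addn_gt0 n0.
rewrite -mulrBl !ler_pM2r // ler_nat leq_subr andbT lerBlDr -natrD ler_nat.
by lia.
Qed.

Lemma prob_series_cvg1 d : probability_vector d -> series d @ \oo --> (1 : R).
Proof.
move=> [d0 d1].
have /cvg_ex[l Hl] : cvgn (fun n => \sum_(0 <= i < n) (d i)%:E)%E.
  by apply: is_cvg_nneseries => i _ _; rewrite lee_fin.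
have El : l = 1%:E by rewrite -[RHS]d1; apply/esym/cvg_lim.
move: Hl; rewrite {}El => /fine_cvg; apply: cvg_trans; apply: near_eq_cvg.
by apply: nearW => n /=; rewrite sumEFin.
Qed.

Lemma prob_series_mono d : probability_vector d ->
  {homo series d : i j / (i <= j)%N >-> i <= j}.
Proof.
move=> [d0 _] i j ij; rewrite /series /= (big_cat_nat (leq0n i) ij) /=.
by rewrite lerDl sumr_ge0.
Qed.

Lemma prob_series_le1 d k : probability_vector d -> series d k <= 1.
Proof.
move=> pd; have H := prob_series_cvg1 _ pd; rewrite -(cvg_lim _ H) //.
apply: nondecreasing_cvgn_le; first exact: prob_series_mono.
by apply/cvg_ex; exists 1.
Qed.

Lemma prob_series_ge0 d k : probability_vector d -> 0 <= series d k.
Proof. by move=> [d0 _]; rewrite /series /= sumr_ge0. Qed.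

(** Rounding the partial sums of N d, rather than its entries, keeps the total
    under control: the differences of consecutive rounded partial sums
    telescope. *)
Lemma exists_rounding d N : probability_vector d -> (0 < N)%N ->
  exists2 t : vertex, degree t = N &
    forall i, (i < N)%N -> `|(t i)%:R / N%:R - d i| <= N%:R^-1.
Proof.
move=> pd N0.
(* The partial sums of d may stay below 1 forever; setting the rounded sum to N
   beyond index N puts the missing mass on coordinate N, which keeps the support
   finite and does not disturb a fixed coordinate once N is large. *)
pose a i := if (i <= N)%N then Num.truncn (series d i * N%:R) else N.
have a0 : a 0%N = 0%N by rewrite /a /= /series /= big_geq // mul0r truncn0.
have NR : 0 <= N%:R :> R by [].
have aN i : (a i <= N)%N.
  rewrite /a; case: ifP => // _; rewrite -(ler_nat R).
  rewrite (le_trans (y := series d i * N%:R)) //.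
    by rewrite truncn_le mulr_ge0 // prob_series_ge0.
  by rewrite -[leRHS]mul1r ler_wpM2r // prob_series_le1.
have am : {homo a : i j / (i <= j)%N}.
  move=> i j ij; rewrite {2}/a; case: ifPn => [jN|_]; last exact: aN.
  rewrite /a (leq_trans ij jN); apply: le_truncn.
  by rewrite ler_wpM2r // prob_series_mono.
pose t : vertex :=
  [fsfun i in [fset k in iota 0 N.+1]%fset => (a i.+1 - a i)%N | 0%N].
have tE i : t i = (a i.+1 - a i)%N.
  rewrite fsfunE; case: ifPn => //.
  rewrite in_fset [X in ~~ X]mem_iota add0n ltnS -ltnNge => Ni.
  by rewrite /a !ifN ?subnn // -ltnNge // ltnS ltnW.
exists t.
  rewrite (@degree_sub [fset k in iota 0 N.+1]%fset); last exact: finsupp_sub.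
  under eq_bigr do rewrite tE.
  transitivity (\sum_(0 <= i < N.+1) (a i.+1 - a i))%N.
    by apply: perm_big; apply: uniq_perm; rewrite ?fset_uniq ?iota_uniq // => i;
      rewrite in_fset.
  by rewrite telescope_sumn // a0 subn0 /a ltnn.
move=> i iN; rewrite tE /a iN (ltnW iN) natrB; last first.
  by rewrite le_truncn // ler_wpM2r // prob_series_mono.
have NR' : 0 < N%:R :> R by rewrite ltr0n.
have /andP[] := truncn_itv (mulr_ge0 (prob_series_ge0 _ i pd) NR).
have /andP[] := truncn_itv (mulr_ge0 (prob_series_ge0 _ i.+1 pd) NR).
have -> : series d i.+1 = series d i + d i by rewrite /series /= big_nat_recr.
set x := Num.trunc _; set y := Num.trunc _.
rewrite -[x.+1]addn1 -[y.+1]addn1 !natrD.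
move=> h1 h2 h3 h4.
have -> : (x%:R - y%:R) / N%:R - d i = ((x%:R - y%:R) - d i * N%:R) / N%:R.
  by rewrite [RHS]mulrBl mulfK // gt_eqF.
rewrite normrM normfV (ger0_norm NR) -[leRHS]mul1r ler_wpM2r ?invr_ge0 //.
rewrite ler_norml; apply/andP; split; nra.
Qed.

Lemma q_vec_limit (n : nat) d : (0 < n)%N -> probability_vector d ->
  limit_vectors n (q_vec n d).
Proof.
move=> n0 pd.
have nm m : (0 < n + m)%N by rewrite addn_gt0 n0.
have tex m : exists t : level (n + m), forall i, (i < n + m)%N ->
    `|(val t i)%:R / (n + m)%:R - d i| <= (n + m)%:R^-1.
  have [t /eqP dt Ht] := exists_rounding _ _ pd (nm m).
  by exists (exist _ t dt).
pose t m := sval (cid (tex m)); have tP m := svalP (cid (tex m)).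
exists t => s.
have ti i : (fun m => (val (t m) i)%:R / (n + m)%:R : R) @ \oo --> d i.
  have inv0 := cvg_invn _ n0.
  have lo : (fun m => d i - (n + m)%:R^-1) @ \oo --> d i.
    by rewrite -[X in _ --> X](subr0 (d i)); apply: cvgB => //; exact: cvg_cst.
  have hi : (fun m => d i + (n + m)%:R^-1) @ \oo --> d i.
    by rewrite -[X in _ --> X](addr0 (d i)); apply: cvgD => //; exact: cvg_cst.
  apply: squeeze_cvgr lo hi; near=> m.
  have := tP m i; rewrite ler_distl; apply.
  by rewrite ltn_addl //; near: m; exists i.+1.
under eq_fun do rewrite g_vec_ffact //.
rewrite /q_vec; apply: cvgMr.
have ds : (\sum_(i <- finsupp (val s)) val s i)%N = n by apply/eqP/(valP s).
have -> : (fun m => (\prod_(i <- finsupp (val s)) val (t m) i ^_ val s i)%N%:R /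
     ((n + m) ^_ n)%N%:R : R) =
  (fun m => \prod_(i <- finsupp (val s))
     ((val (t m) i ^_ val s i)%:R / (n + m)%:R ^+ val s i)) \*
  (fun m => (((n + m) ^_ n)%:R / (n + m)%:R ^+ n)^-1).
  apply/funext => m /=; rewrite big_split /= natr_prod prodfV prodrXr.
  rewrite ds invfM invrK -[RHS]mulrA [X in _ = _ * X]mulrCA mulVf ?mulr1 //.
  by rewrite expf_eq0 pnatr_eq0 n0 /= -lt0n nm.
rewrite -[X in _ --> X]mulr1; apply: cvgM.
  by apply: cvg_prod_seq => i; apply: cvg_ffact.
rewrite -[X in _ --> X]invr1; apply: cvgV; first exact: oner_neq0.
rewrite -[X in _ --> X](expr1n _ n); apply: cvg_ffact => //.
by under eq_fun do rewrite divff ?pnatr_eq0 -?lt0n //; exact: cvg_cst.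
Unshelve. all: by end_near.
Qed.
End Limits.

(** * Borel sets of the path space *)

Lemma path_of_letters_start (x : nat -> nat) :
  degree (foldl vstep vertex0 (mkseq x 1)) = 1%N.
Proof. by rewrite degree_foldl degree0. Qed.

Lemma path_of_letters_step (x : nat -> nat) k :
  edge (foldl vstep vertex0 (mkseq x k.+1))
       (foldl vstep vertex0 (mkseq x k.+2)).
Proof.
by apply/edgeP; exists (x k.+1); rewrite [mkseq x k.+2]mkseqS foldl_rcons.
Qed.

Definition path_of_letters (x : nat -> nat) : path_space :=
  @PathSpace (fun k => foldl vstep vertex0 (mkseq x k.+1))
    (path_of_letters_start x) (path_of_letters_step x).

Lemma exists_letters (w : path_space) : exists x : nat -> nat,
  forall k, w k = foldl vstep vertex0 (mkseq x k.+1).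
Proof.
have [i0 wi0] : exists i, w 0%N = vstep vertex0 i.
  have := size_spell (w 0%N); have := foldl_spell (w 0%N); rewrite path_start.
  by case: (spell _) => [//|i [|//]] /= <- _; exists i.
have /choice[f wf] : forall k, exists i, w k.+1 = vstep (w k) i.
  by move=> k; apply/edgeP; exact: path_step.
pose x k := if k is k'.+1 then f k' else i0.
exists x; elim=> [|k IH]; first by rewrite wi0.
by rewrite mkseqS foldl_rcons -IH wf.
Qed.

Definition letters (w : path_space) : nat -> nat :=
  sval (cid (exists_letters w)).

Lemma lettersP (w : path_space) k :
  w k = foldl vstep vertex0 (mkseq (letters w) k.+1).
Proof. exact: (svalP (cid (exists_letters w))). Qed.

(** Unlike the cylinders of finite paths, these include the whole space, as the
    cylinder of the empty word. *)
Definition word_cylinder (v : seq nat) : set path_space :=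
  [set w | mkseq (letters w) (size v) = v].

Lemma take_mkseq (T : Type) (x : nat -> T) k n : (k <= n)%N ->
  take k (mkseq x n) = mkseq x k.
Proof. by move=> kn; rewrite -map_take take_iota (minn_idPl kn). Qed.

Lemma mkseq_vertices (x : nat -> nat) (v : seq nat) :
  (forall k, (k < size v)%N -> foldl vstep vertex0 (mkseq x k.+1) =
     foldl vstep vertex0 (take k.+1 v)) <-> mkseq x (size v) = v.
Proof.
split=> [H|<- k kv]; last by rewrite size_mkseq in kv; rewrite take_mkseq.
apply: (scanl_vstep_inj vertex0).
apply: (@eq_from_nth _ vertex0); rewrite !size_scanl size_mkseq // => k kv.
by rewrite !nth_scanl ?size_mkseq // -H // take_mkseq.
Qed.

Lemma cylinder_word (e : vertex * seq vertex) (v : seq nat) :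
  e.1 :: e.2 = scanl vstep vertex0 v -> cylinder e = word_cylinder v.
Proof.
move=> ev; have sv : (size e.2).+1 = size v.
  by rewrite -(size_scanl vstep vertex0 v) -ev.
apply/seteqP; split=> w.
  move=> wH; apply/mkseq_vertices => k kv.
  by rewrite -lettersP wH -1?ltnS ?sv // ev nth_scanl.
move=> /mkseq_vertices wH k; rewrite -ltnS sv => kv.
by rewrite lettersP wH // ev nth_scanl.
Qed.

Lemma letters_path x : letters (path_of_letters x) = x.
Proof.
apply/funext => k.
have : mkseq x k.+1 = mkseq (letters (path_of_letters x)) k.+1.
  rewrite -[k.+1 in LHS](size_mkseq (letters (path_of_letters x))).
  apply/mkseq_vertices => j; rewrite size_mkseq => jk.
  by rewrite take_mkseq // -lettersP.
rewrite !mkseqS => /rcons_inj[_ -> //].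
Qed.

Lemma word_cylinder_path (v : seq nat) : v != [::] ->
  exists2 e, paths_from_V1 (foldl vstep vertex0 v) e &
    cylinder e = word_cylinder v.
Proof.
case: v => // i v _; exists (vstep vertex0 i, scanl vstep (vstep vertex0 i) v).
  by apply/paths_from_V1P; exists (i :: v).
by apply: cylinder_word.
Qed.

Lemma word_cylinder0 : word_cylinder [::] = setT.
Proof. by apply/seteqP; split. Qed.

(** Cylinders are nested or disjoint, as in an ultrametric space. *)
Lemma word_cylinder_sub (u v : seq nat) (w : path_space) :
  word_cylinder u w -> word_cylinder v w -> (size u <= size v)%N ->
  word_cylinder v `<=` word_cylinder u.
Proof.
move=> wu wv uv w' w'v; change (mkseq (letters w') (size u) = u).
have {}w'v : mkseq (letters w') (size v) = v by [].
have {}wv : mkseq (letters w) (size v) = v by [].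
by rewrite -(take_mkseq _ _ _ _ uv) w'v -wv take_mkseq.
Qed.

Lemma open_word_cylinder v : open (word_cylinder v).
Proof.
have [->|/word_cylinder_path[e He <-]] := eqVneq v [::].
  by rewrite word_cylinder0; exact: openT.
exists [set (cylinder e)]; last by rewrite bigcup_set1.
move=> _ ->; exists [fset (cylinder e)]%fset.
  move=> _ /fset1P ->; apply/mem_set; exists e => //.
  by exists (foldl vstep vertex0 v).
apply/seteqP; split=> [w ew|w ew _ /fset1P -> //].
by apply: (ew (cylinder e)); rewrite /= inE.
Qed.

(** The cylinders around w are those of its prefixes, and they decrease: among
    finitely many of them the one of the longest prefix lies in all the
    others. *)
Lemma open_sub_word_cylinder (A : set path_space) w : open A -> A w ->
  exists n, word_cylinder (mkseq (letters w) n) `<=` A.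
Proof.
move=> [D DfinI <-] [B DB Bw].
suff [n Hn] : exists n, word_cylinder (mkseq (letters w) n) `<=` B.
  by exists n => w' /Hn Bw'; exists B.
have [E Ecyl EB] := DfinI _ DB.
have EcylP C : C \in E -> exists n, word_cylinder (mkseq (letters w) n) `<=` C.
  move=> CE; have /set_mem[e [t _ /paths_from_V1P[v _ [ev _]]] Ce] := Ecyl _ CE.
  exists (size v); rewrite -Ce (cylinder_word _ _ ev).
  have : C w by move: Bw; rewrite -EB; apply.
  by rewrite -Ce (cylinder_word _ _ ev) => ->.
have /choice[f fP] : forall C : set path_space, exists n, C \in E ->
    word_cylinder (mkseq (letters w) n) `<=` C.
  move=> C; have [/EcylP[n]|] := boolP (C \in E); first by exists n.
  by exists 0%N.
exists (\max_(C <- E) f C) => w' ww'; rewrite -EB => C CE.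
apply: (fP C CE); apply: (@word_cylinder_sub _ _ w) ww'.
- by rewrite /word_cylinder /= size_mkseq.
- by rewrite /word_cylinder /= size_mkseq.
by rewrite !size_mkseq; exact: leq_bigmax_seq.
Qed.

Lemma measurable_word_cylinder v :
  measurable (word_cylinder v : set borel_path_space).
Proof. by apply: sub_sigma_algebra; exact: open_word_cylinder. Qed.

(** An open set is the union of the cylinders that it contains, and this union
    is countable because there are countably many words. *)
Lemma measurable_cylindersE :
  @measurable _ borel_path_space = <<s range word_cylinder >>.
Proof.
apply/seteqP; split.
  apply: smallest_sub; first exact: smallest_sigma_algebra.
  move=> A oA.
  have -> : A = \bigcup_(v : seq nat)
      (if `[< word_cylinder v `<=` A >] then word_cylinder v else set0).
    apply/seteqP; split => [w Aw|w [v _]].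
      have [n nA] := open_sub_word_cylinder _ _ oA Aw.
      exists (mkseq (letters w) n) => //.
      by rewrite asboolT // /word_cylinder /= size_mkseq.
    by case: asboolP => // sub /sub.
  apply: (@countable_bigcupT_measurable _
    (g_sigma_algebraType (range word_cylinder))) => // v.
  case: asboolP => _; last exact: sigma_algebra0.
  by apply: sub_sigma_algebra; exists v.
apply: smallest_sub; first exact: sigma_algebra_measurable.
by move=> _ [v _ <-]; exact: measurable_word_cylinder.
Qed.

(** Nonempty words suffice: the cylinder of the empty word has measure 1 under
    both probabilities. It still belongs to the generating family, where it
    covers the space and makes the family stable under intersection together
    with the empty set. *)
Lemma measure_cylinders_unique (R : realType)
    (mu nu : probability borel_path_space R) :
  (forall v, v != [::] -> mu (word_cylinder v) = nu (word_cylinder v)) ->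
  forall A : set borel_path_space, measurable A -> mu A = nu A.
Proof.
move=> H A mA.
apply: (@measure_unique _ R borel_path_space (set0 |` range word_cylinder)
  (fun=> setT) _ _ _ _ mu nu _ _ A mA).
- rewrite measurable_cylindersE; apply/seteqP; split.
    apply: smallest_sub; first exact: smallest_sigma_algebra.
    by move=> B HB; apply: sub_sigma_algebra; right.
  apply: smallest_sub; first exact: smallest_sigma_algebra.
  by move=> B [->|HB]; [exact: sigma_algebra0|exact: sub_sigma_algebra].
- move=> B C [->|[u _ <-]]; first by rewrite set0I; left.
  case=> [->|[v _ <-]]; first by rewrite setI0; left.
  have [->|/set0P[w [wu wv]]] :=
    eqVneq (word_cylinder u `&` word_cylinder v) set0.
    by left.
  right; have [uv|/ltnW vu] := leqP (size u) (size v).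
    by exists v => //; apply/esym/setIidr/(word_cylinder_sub _ _ _ wu wv uv).
  by exists u => //; apply/esym/setIidl/(word_cylinder_sub _ _ _ wv wu vu).
- by move=> _; right; exists [::] => //; exact: word_cylinder0.
- by rewrite bigcup_const.
- move=> B [->|[v _ <-]]; first by rewrite !measure0.
  have [->|] := eqVneq v [::]; last exact: H.
  rewrite word_cylinder0.
  exact: etrans (probability_setT mu) (esym (probability_setT nu)).
- by move=> _ /=; rewrite probability_setT ltry.
Qed.

(** * The measure with independent letters *)

Section Sampling.
Variables (R : realType) (d : nat -> R).
Hypothesis pd : probability_vector d.

Let d0 i : 0 <= d i. Proof. by case: pd => + _; apply. Qed.

Lemma series_succ i : series d i.+1 = series d i + d i.
Proof. by rewrite /series /= big_nat_recr. Qed.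

Definition digit (u : R) : nat :=
  xget 0%N [set i | series d i <= u < series d i.+1].

(** The position of u inside the interval of its digit, blown up to
    [0, 1[. *)
Definition rescale (u : R) : R := (u - series d (digit u)) / d (digit u).

Definition digits (u : R) (k : nat) : nat := digit (iter k rescale u).

Lemma digitE u i : series d i <= u < series d i.+1 -> digit u = i.
Proof.
move=> Hi; rewrite /digit; case: xgetP => [j _ /= Hj|/(_ i)//].
move: Hi Hj => /andP[i1 i2] /andP[j1 j2].
apply/eqP; rewrite eqn_leq; apply/andP; split; rewrite leqNgt; apply/negP.
  move=> /(prob_series_mono _ _ pd) H.
  by move: (lt_le_trans i2 H); rewrite ltNge j1.
move=> /(prob_series_mono _ _ pd) H.
by move: (lt_le_trans j2 H); rewrite ltNge i1.
Qed.

Lemma digitP u : 0 <= u < 1 -> series d (digit u) <= u < series d (digit u).+1.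
Proof.
move=> /andP[u0 u1].
suff [i Hi] : exists i, series d i <= u < series d i.+1 by rewrite (digitE u i).
have ex : exists n, u < series d n.
  have := prob_series_cvg1 _ _ pd => /cvgr_gt /(_ u u1)[N _ HN].
  by exists N; apply: HN => /=.
case: (ex_minnP ex) => -[|i] ui mini.
  by move: ui; rewrite /series /= big_geq // ltNge u0.
by exists i; rewrite ui andbT leNgt; apply/negP => /mini; rewrite ltnn.
Qed.

(** The left end of the interval of numbers whose digits begin with v: the
    interval of the first letter is an affine copy of [0, 1[ with ratio d_i, and
    it contains the interval of the remaining letters, shrunk accordingly. *)
Definition cell_left (v : seq nat) : R :=
  foldr (fun i a => series d i + d i * a) 0 v.
Definition cell_width (v : seq nat) : R := \prod_(i <- v) d i.

Lemma cell_width_ge0 v : 0 <= cell_width v.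
Proof. by rewrite /cell_width prodr_ge0. Qed.

Lemma cell_bounds v : 0 <= cell_left v /\ cell_left v + cell_width v <= 1.
Proof.
elim: v => [|i v [l0 r1]] /=; first by rewrite /cell_width big_nil add0r.
have := cell_width_ge0 v; have := prob_series_le1 _ _ i.+1 pd.
rewrite series_succ; have := prob_series_ge0 _ _ i pd; have := d0 i.
rewrite /cell_width big_cons -/(cell_width v).
by move=> *; split; nra.
Qed.

(** By induction on v, as [rescale] is the inverse of that affine map. When
    d_i = 0 for some letter i of v, the cell is empty, and indeed no u in [0, 1[
    has the digit i. *)
Lemma digits_cell u v : 0 <= u < 1 ->
  mkseq (digits u) (size v) = v <->
  cell_left v <= u < cell_left v + cell_width v.
Proof.
elim: v u => [|i v IH] u u01.
  by rewrite /cell_width big_nil add0r; split.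
have := digitP u u01; have := cell_bounds v; have := cell_width_ge0 v.
have step : mkseq (digits u) (size (i :: v)) =
    digit u :: mkseq (digits (rescale u)) (size v).
  rewrite /mkseq /= (iotaDl 1 0) -map_comp; congr (_ :: _).
  by apply: eq_map => k; rewrite /digits /= -iterSr.
rewrite step -[cell_left (i :: v)]/(series d i + d i * cell_left v).
rewrite /cell_width big_cons -/(cell_width v).
move=> w0 [l0 r1] /andP[]; rewrite series_succ => Du uD.
have key : digit u = i -> 0 < d i ->
    (mkseq (digits (rescale u)) (size v) = v <->
     series d i + d i * cell_left v <= u <
      series d i + d i * cell_left v + d i * cell_width v).
  move=> ui di; rewrite ui in Du uD; rewrite IH.
    by rewrite /rescale ui ler_pdivlMr // ltr_pdivrMr // lerBrDl ltrBlDl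
      mulrDl !(mulrC _ (d i)) addrA.
  by rewrite /rescale ui divr_ge0 ?subr_ge0 // ltr_pdivrMr // mul1r ltrBlDl.
split=> [[ui vE]|H].
  by apply/(key ui) => //; rewrite -ui; lra.
have /andP[H1 H2] := H.
have di : 0 < d i.
  by rewrite lt_neqAle d0 andbT; apply/eqP => di; move: H1 H2; rewrite -di; lra.
have ui : digit u = i.
  have a0 : 0 <= d i * cell_left v by rewrite mulr_ge0.
  have a1 : d i * (cell_left v + cell_width v) <= d i by rewrite ler_piMr.
  apply: digitE; rewrite series_succ; move: a1; rewrite mulrDr => a1.
  by apply/andP; split; lra.
by rewrite ui; congr (_ :: _); apply/key.
Qed.

(** Outside [0, 1[, which carries the whole mass, any constant value makes the
    map measurable. *)
Definition sample (u : measurableTypeR R) : borel_path_space :=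
  if 0 <= u < 1 then path_of_letters (digits u)
  else path_of_letters (fun=> 0%N).

Lemma sample_cylinder v :
  sample @^-1` word_cylinder v `&` `[0, 1[ =
  `[cell_left v, cell_left v + cell_width v[%classic.
Proof.
have [l0 r1] := cell_bounds v.
apply/seteqP; split => u /=.
  move=> []; rewrite in_itv /= /sample => + u01; rewrite u01 /word_cylinder /=.
  by rewrite letters_path => /digits_cell; rewrite in_itv; apply.
rewrite in_itv /= => Hu; have u01 : 0 <= u < 1 by lra.
rewrite in_itv /= u01; split => //; rewrite /sample u01 /word_cylinder /=.
by rewrite letters_path; apply/digits_cell.
Qed.

Lemma measurable_sample : measurable_fun setT sample.
Proof.
apply: (@measurability _ _ _ borel_path_space setT sample _
  measurable_cylindersE).
move=> _ [_ [v _ <-] <-]; rewrite setTI.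
rewrite -(setIT (_ @^-1` _)) -(setUv `[0, 1[%classic) setIUr.
apply: measurableU; first by rewrite sample_cylinder; exact: measurable_itv.
have [c|c] := pselect (word_cylinder v (path_of_letters (fun=> 0%N))).
  suff -> : sample @^-1` word_cylinder v `&` ~` `[0, 1[ = ~` `[0, 1[.
    by apply: measurableC; exact: measurable_itv.
  apply/setIidr => u /=; rewrite in_itv /= => /negP/negbTE u01.
  by rewrite /sample u01.
suff -> : sample @^-1` word_cylinder v `&` ~` `[0, 1[ = set0 by [].
apply/seteqP; split => u //= []; rewrite in_itv /= => + /negP/negbTE u01.
by rewrite /sample u01.
Qed.

HB.instance Definition _ :=
  isMeasurableFun.Build _ _ _ _ sample measurable_sample.

Lemma measurable_unit : measurable (`[0, 1[%classic : set (measurableTypeR R)).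
Proof. exact: measurable_itv. Qed.

Definition uniform_unit : set (measurableTypeR R) -> \bar R :=
  mrestr lebesgue_measure measurable_unit.

HB.instance Definition _ := Measure.on uniform_unit.

Let uniform_unit_setT : uniform_unit setT = 1%E.
Proof.
rewrite /uniform_unit /mrestr setTI.
by rewrite lebesgue_measure_itv /= lte_fin ltr01 oppr0 adde0.
Qed.

HB.instance Definition _ :=
  Measure_isProbability.Build _ _ _ uniform_unit uniform_unit_setT.

Definition sampling_measure : probability borel_path_space R :=
  distribution uniform_unit sample.

Lemma sampling_cylinder v :
  sampling_measure (word_cylinder v) = (\prod_(i <- v) d i)%:E.
Proof.
rewrite /sampling_measure /= /distribution /pushforward /uniform_unit /mrestr.
rewrite sample_cylinder lebesgue_measure_itv /=.
rewrite lte_fin ltrDl -EFinD addrAC subrr add0r; case: ifPn => //.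
rewrite -leNgt => w0; congr EFin; apply/eqP; rewrite eq_le w0 andbT.
exact: cell_width_ge0.
Qed.

End Sampling.

(** * Measures of the sets X_s *)

Lemma prod_letters (R : realType) (d : nat -> R) (v : seq nat) :
  \prod_(i <- finsupp (foldl vstep vertex0 v)) d i ^+ foldl vstep vertex0 v i =
  \prod_(i <- v) d i.
Proof.
set s := foldl _ _ _.
have sE i : s i = count_mem i v by rewrite /s foldl_vstepE vertex0E.
rewrite -[RHS]big_undup_iterop_count (perm_big (undup v)).
  by apply: eq_bigr => i _; rewrite sE.
apply: uniq_perm; rewrite ?fset_uniq ?undup_uniq // => i.
by rewrite mem_undup mem_finsupp sE -lt0n -has_count has_pred1.
Qed.

Lemma q_vecE (R : realType) (n : nat) (d : nat -> R) (s : level n) :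
  (0 < n)%N -> q_vec n d s = (height (val s))%:R * p_vec n d s.
Proof.
move=> n0; have ds : degree (val s) = n by apply/eqP/(valP s).
have := height_fact (val s) _ (fsubset_refl _); rewrite ds => /(_ n0) H.
rewrite /q_vec -H natrM mulfK // pnatr_eq0 -lt0n.
by apply: prodn_gt0 => i; rewrite fact_gt0.
Qed.

Lemma height_gt0 (t : vertex) : (0 < degree t)%N -> (0 < height t)%N.
Proof.
move=> t0; have := height_fact t _ (fsubset_refl _) t0.
by case: height => // /esym/eqP; rewrite mul0n -[_ == _]negbK -lt0n fact_gt0.
Qed.

Lemma height_words (t : vertex) : (0 < degree t)%N ->
  height t = size (permutations (spell t)).
Proof.
by move=> t0; rewrite height_num_paths // -{1}(foldl_spell t) num_paths_foldl.
Qed.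

Lemma perm_spell v t : perm_eq v (spell t) <-> foldl vstep vertex0 v = t.
Proof. by rewrite -(foldl_vstep_perm vertex0) foldl_spell. Qed.

Lemma through_words n (s : level n) : (0 < n)%N -> through s =
  \bigcup_(v in [set` permutations (spell (val s))]) word_cylinder v.
Proof.
move=> n0; have ds : degree (val s) = n by apply/eqP/(valP s).
apply/seteqP; split=> [w wn|w [v /=]].
  exists (mkseq (letters w) n); last by rewrite /word_cylinder /= size_mkseq.
  by rewrite /= mem_permutations; apply/perm_spell; rewrite -wn lettersP prednK.
rewrite mem_permutations => /[dup] /perm_size; rewrite size_spell ds => vn.
move=> /perm_spell vs wv; rewrite /through /= lettersP prednK //.
by rewrite -vs -[in RHS]wv vn.
Qed.

Lemma word_cylinder_disjoint u v w : size u = size v ->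
  word_cylinder u w -> word_cylinder v w -> u = v.
Proof. by rewrite /word_cylinder /= => uv <- <-; rewrite uv. Qed.

Section Measures.
Variables (R : realType) (mu : probability borel_path_space R).

Lemma measure_through n (s : level n) (c : R) : (0 < n)%N ->
  (forall v, perm_eq v (spell (val s)) -> mu (word_cylinder v) = c%:E) ->
  mu (through s) = ((height (val s))%:R * c)%:E.
Proof.
move=> n0 H; have ds : degree (val s) = n by apply/eqP/(valP s).
rewrite through_words // measure_fin_bigcup.
- rewrite -fsbig_seq ?permutations_uniq //.
  rewrite (eq_big_seq (fun=> c%:E)) => [|v]; last first.
    by rewrite mem_permutations => /H.
  rewrite sumEFin big_const_seq count_predT iter_addr_0 height_words ?ds //.
  by rewrite mulr_natl.
- exact: finite_seq.
- move=> u v /=; rewrite !mem_permutations.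
  move=> /perm_size us /perm_size vs [w [uw vw]].
  by apply: word_cylinder_disjoint uw vw; rewrite us vs.
- by move=> v _; exact: measurable_word_cylinder.
Qed.

(** An infinite path beginning with v has exactly one letter after v. *)
Lemma measure_word_split v :
  mu (word_cylinder v) = (\sum_(0 <= j <oo) mu (word_cylinder (rcons v j)))%E.
Proof.
have -> : word_cylinder v = \bigcup_j word_cylinder (rcons v j).
  apply/seteqP; split=> [w wv|w [j _]].
    exists (letters w (size v)) => //.
    by rewrite /word_cylinder /= size_rcons mkseqS wv.
  by rewrite /word_cylinder /= size_rcons mkseqS => /rcons_inj[].
rewrite measure_bigcup; last 2 first.
- by move=> j _; exact: measurable_word_cylinder.
- move=> i j _ _ [w [wi wj]].
  have /rcons_inj[] // : rcons v i = rcons v j.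
  by apply: word_cylinder_disjoint wi wj; rewrite !size_rcons.
by apply: eq_eseriesl => j; rewrite in_setT.
Qed.

Lemma tail_invariant_word : tail_invariant mu -> forall u v,
  perm_eq u v -> mu (word_cylinder u) = mu (word_cylinder v).
Proof.
move=> tmu u v uv.
have [u0|/[dup] u0 /word_cylinder_path[e He <-]] := eqVneq u [::].
  by move: uv; rewrite u0 perm_sym => /perm_nilP ->.
have /word_cylinder_path[e' He' <-] : v != [::].
  by apply: contraNneq u0 => v0; move: uv; rewrite v0 => /perm_nilP ->.
apply: tmu He _; suff -> : foldl vstep vertex0 u = foldl vstep vertex0 v by [].
exact/foldl_vstep_perm.
Qed.

Lemma word_level (v : seq nat) : degree (foldl vstep vertex0 v) == size v.
Proof. by rewrite degree_foldl degree0. Qed.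

Definition word_end (v : seq nat) : level (size v) :=
  exist (fun s : vertex => degree s == size v) _ (word_level v).

(** Tail invariance spreads the mass of X_s evenly over the H_s cylinders that
    compose it, and q_s is H_s times p_s. *)
Lemma measure_word (n : nat) (d : nat -> R) (v : seq nat) :
  size v = n -> (0 < n)%N -> tail_invariant mu ->
  (forall s : level n, mu (through s) = (q_vec n d s)%:E) ->
  mu (word_cylinder v) = (\prod_(i <- v) d i)%:E.
Proof.
move=> <- n0 tmu H; pose s := word_end v.
have cfin : mu (word_cylinder v) \is a fin_num.
  by apply: fin_num_measure; exact: measurable_word_cylinder.
have := H s.
rewrite (@measure_through _ s (fine (mu (word_cylinder v)))) //; last first.
  move=> u us; rewrite fineK //; apply: tail_invariant_word => //.
  by apply/(foldl_vstep_perm vertex0); apply/perm_spell.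
rewrite q_vecE // => -[] /mulfI E.
rewrite -(fineK cfin) E /p_vec ?prod_letters //.
by rewrite pnatr_eq0 -lt0n height_gt0 // (eqP (word_level v)).
Qed.

End Measures.

Lemma sampling_path_cylinder (R : realType) (d : nat -> R)
    (pd : probability_vector d) t e : paths_from_V1 t e ->
  sampling_measure R d pd (cylinder e) = (\prod_(i <- finsupp t) d i ^+ t i)%:E.
Proof.
move=> /paths_from_V1P[v _ [ev ->]].
by rewrite (cylinder_word _ _ ev) sampling_cylinder prod_letters.
Qed.

Theorem proposition5p9 (R : realType) :
  (forall d : nat -> R, probability_vector d ->
    exists2 mu : probability borel_path_space R,
      tail_invariant mu /\
      (forall (n : nat) (s : level n) (e : vertex * seq vertex), (0 < n)%N ->
        paths_from_V1 (val s) e -> mu (cylinder e) = (p_vec n d s)%:E) &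
      forall nu : probability borel_path_space R,
        tail_invariant nu ->
        (forall (n : nat) (s : level n) (e : vertex * seq vertex), (0 < n)%N ->
          paths_from_V1 (val s) e -> nu (cylinder e) = (p_vec n d s)%:E) ->
        forall A : set borel_path_space, measurable A -> nu A = mu A) /\
  (forall dn : nat -> nat -> R,
    (forall n, (0 < n)%N -> probability_vector (dn n)) ->
    (forall n, (0 < n)%N -> limit_vectors n (q_vec n (dn n))) /\
    ((exists mu : probability borel_path_space R,
        tail_invariant mu /\
        forall (n : nat) (s : level n), (0 < n)%N ->
          mu (through s) = (q_vec n (dn n) s)%:E)
     <->
     (exists d : nat -> R, forall n, (0 < n)%N -> dn n = d))).
Proof.
have tail (d : nat -> R) (pd : probability_vector d) :
    tail_invariant (sampling_measure R d pd).
  move=> t e e' He He'.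
  exact: etrans (sampling_path_cylinder _ _ pd _ _ He)
    (esym (sampling_path_cylinder _ _ pd _ _ He')).
split=> [d pd|dn pdn].
  exists (sampling_measure R d pd); first split => //.
    by move=> n s e _ He; rewrite (sampling_path_cylinder _ _ _ (val s)).
  move=> nu _ nuE; apply: measure_cylinders_unique => v v0.
  have [e He <-] := word_cylinder_path v v0.
  rewrite (sampling_path_cylinder _ _ _ _ _ He).
  by apply: (nuE _ (word_end v) e _ He); rewrite lt0n size_eq0.
split=> [n n0|]; first by apply: q_vec_limit => //; exact: pdn.
split=> [[mu [tmu muE]]|[d dE]]; last first.
  have pd : probability_vector d by rewrite -(dE 1%N) //; exact: pdn.
  exists (sampling_measure R d pd); split => // n s n0.
  rewrite dE // q_vecE //; apply: measure_through => // v /perm_spell vs.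
  by rewrite sampling_cylinder /p_vec -vs prod_letters.
(* Consecutive vectors are compared on the cylinder of n copies of i, whose
   measure is a power of the single entry d_i; nonnegative numbers are determined
   by their n-th powers. *)
exists (dn 1%N); elim=> // -[//|n] IH _; rewrite -IH //.
apply/funext => i; apply/esym/eqP.
have [d0 _] := pdn n.+1 isT; have [d0' d1'] := pdn n.+2 isT.
rewrite -(@eqrXn2 _ n.+1) //; apply/eqP.
have := measure_word_split R mu (nseq n.+1 i).
rewrite (measure_word _ _ n.+1 (dn n.+1)) ?size_nseq //; last first.
  by move=> s; exact: muE.
have E j : mu (word_cylinder (rcons (nseq n.+1 i) j)) =
    ((dn n.+2 i ^+ n.+1)%:E * (dn n.+2 j)%:E)%E.
  rewrite (measure_word _ _ n.+2 (dn n.+2)) ?size_rcons ?size_nseq //.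
    by rewrite -cats1 big_cat big_seq1 big_nseq iter_mulr_1.
  by move=> s; exact: muE.
under eq_eseriesr do rewrite E.
rewrite nneseriesZl ?d1' ?mule1 ?lee_fin ?exprn_ge0 //; last first.
  by move=> j _; rewrite lee_fin.
by rewrite big_nseq iter_mulr_1 => -[].
Qed.
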